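(* There is a function $L(n) = O(\log n \log\log n)$ such that for every directed graph $G=(V,E,\ell)$ with $n=|V|$ nodes and positive edge lengths bounded by $\mathrm{poly}(n)$, and for every parameter $D \ge 1$, there exists a directed low-diameter decomposition for $G$ and $D$ with loss $L(n)$.
   Context: A directed low-diameter decomposition (LDD) with loss $L$ for a directed edge-weighted graph $G=(V,E,\ell)$ and a parameter $D\ge 1$ is a probability distribution over edge sets $S\subseteq E$ such that: (1) for any two nodes $u,v\in V$ lying in the same strongly connected component of $G\setminus S$ (the graph with the edges of $S$ removed), $d_G(u,v)\le D$ and $d_G(v,u)\le D$, where $d_G$ is the shortest-path distance in the original graph $G$ with respect to $\ell$; and (2) for every edge $e\in E$, $\Pr(e\in S)\le \frac{\ell(e)}{D}\cdot L$. Standing assumption: edge lengths are positive and the maximum edge length is bounded by a polynomial in $n$. *)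

(* Defs.v *)
From HB Require Import structures.
From mathcomp Require Import all_boot all_order all_algebra.
From mathcomp Require Import all_classical all_reals all_analysis.

Set Implicit Arguments.
Unset Strict Implicit.
Unset Printing Implicit Defensive.

Import Order.TTheory GRing.Theory Num.Theory.
Import numFieldNormedType.Exports.

Local Open Scope classical_set_scope.
Local Open Scope ring_scope.

(* Only the values of [len] on [edges] are meaningful. *)
Record wdigraph (R : realType) (V : finType) := WDigraph {
  edges : {set V * V};
  len : V * V -> R
}.

Section Digraph.
Context {R : realType} {V : finType}.
Implicit Types (G : wdigraph R V) (S : {set V * V}) (u v : V) (p : seq V).

Definition adj (F : {set V * V}) : rel V := [rel u v | (u, v) \in F].

(* The walk visits u and then the vertices of p in order. *)
Definition walk_length G u p : R :=
  \sum_(l <- pairmap (fun x y => len G (x, y)) u p) l.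

(* Equal to +oo when v is not reachable from u. *)
Definition dist G u v : \bar R :=
  ereal_inf [set (walk_length G u p)%:E | p in
    [set p | path (adj (edges G)) u p /\ last u p = v]].

Definition same_scc (F : {set V * V}) u v : bool :=
  connect (adj F) u v && connect (adj F) v u.

End Digraph.

Section FiniteDistribution.
Context {R : realType} {T : finType}.
Implicit Types mu : {ffun T -> R}.

Definition is_distribution mu : Prop :=
  (forall x, 0 <= mu x) /\ \sum_x mu x = 1.

Definition Prob mu (A : pred T) : R := \sum_(x | A x) mu x.

End FiniteDistribution.

Record is_directed_ldd (R : realType) (V : finType) (G : wdigraph R V)
    (D L : R) (mu : {ffun {set V * V} -> R}) : Prop := IsDirectedLDD {
  ldd_distribution : is_distribution mu;
  ldd_sub : forall S, mu S != 0 -> S \subset edges G;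
  ldd_diameter : forall S, mu S != 0 ->
    forall u v : V, same_scc (edges G :\: S) u v ->
    (dist G u v <= D%:E)%E /\ (dist G v u <= D%:E)%E;
  ldd_loss : forall e, e \in edges G ->
    Prob mu (fun S => e \in S) <= len G e / D * L
}.

(* Main.v *)
(** By Blackwell's approachability argument (an approximate minimax theorem) it
    suffices to find, for all edge weights [w], one edge set [S] with low-diameter
    components and [D * \sum_(e in S) w e / len e <= loss * \sum_e w e]. Such an
    [S] comes from Seymour's region growing: as long as some pair is at distance
    more than [D], the out-ball of the first or the in-ball of the second vertex,
    of radius [D / 2], holds at most half of the volume [m]; some smaller ball, of
    volume [a], has a boundary of cost [O(log log n / D) * a * ln (m / a)], and one
    recurses on both sides. The terms [a * ln (m / a)] telescope against the
    potential [m * ln (m / beta)], where [beta] is the seed volume of a vertex, and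
    they sum to [O(log n)] times the total weight. *)

Require Import Defs.
From HB Require Import structures.
From mathcomp Require Import all_boot all_order all_algebra.
From mathcomp Require Import all_classical all_reals all_analysis.
From mathcomp Require Import ring lra.

Set Implicit Arguments.
Unset Strict Implicit.
Unset Printing Implicit Defensive.

Import Order.TTheory GRing.Theory Num.Theory.
Import numFieldNormedType.Exports.

Local Open Scope classical_set_scope.
Local Open Scope ring_scope.

(** * Blackwell approachability of the negative orthant for finite vector payoffs *)

Section Approachability.
Context {R : realType} {X I : finType}.
Implicit Types (a : X -> I -> R) (Q : X -> Prop).

(** Second-order upper bound for the square of the positive part, whose derivative [2 * max 0 y] is
    2-Lipschitz. *)
Lemma sqr_pos_part_add (y b : R) :
  Num.max 0 (y + b) ^+ 2 <= Num.max 0 y ^+ 2 + 2 * (Num.max 0 y * b) + b ^+ 2.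
Proof.
rewrite !maxEle; case: ifP => h1; case: ifP => h2; first by nra.
- have [h3 h4] : y < 0 /\ 0 <= y + b by split; lra.
  nra.
- by have := sqr_ge0 (y + b); lra.
- by have := sqr_ge0 b; lra.
Qed.

(* The squared distance of the cumulative payoff vector to the negative orthant
   grows at most linearly in the number of rounds. *)
Lemma approachability_rounds a Q :
  (forall w : I -> R, (forall i, 0 <= w i) ->
     exists2 x, Q x & \sum_i w i * a x i <= 0) ->
  forall T : nat, exists nu : {ffun X -> R},
    [/\ forall x, 0 <= nu x, \sum_x nu x = T%:R, forall x, nu x != 0 -> Q x &
        \sum_i Num.max 0 (\sum_x nu x * a x i) ^+ 2
          <= T%:R * \sum_x \sum_i a x i ^+ 2].
Proof.
move=> orc; elim=> [|T [nu [nu0 nuT nuQ nuB]]].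
  exists [ffun=> 0]; split=> [x|||].
  - by rewrite ffunE.
  - by rewrite big1 // => x _; rewrite ffunE.
  - by move=> x; rewrite ffunE eqxx.
  - rewrite mul0r big1 // => i _; rewrite big1 ?maxxx ?expr0n // => x _.
    by rewrite ffunE mul0r.
(* Weighting by the positive parts of the cumulative payoffs makes the cross terms of
   [sqr_pos_part_add] sum to at most 0. *)
have [x Qx ax] := orc (fun i => Num.max 0 (\sum_x nu x * a x i))
  (fun i => ltac:(by rewrite le_max lexx)).
exists [ffun y => nu y + (y == x)%:R]; split=> [y|||].
- by rewrite ffunE addr_ge0.
- under eq_bigr do rewrite ffunE.
  rewrite big_split /= nuT -natr1; congr (_ + _).
  by rewrite (bigD1 x) //= eqxx big1 ?addr0 // => y /negbTE ->.
- move=> y; rewrite ffunE; case: (eqVneq y x) => [->//|_]; rewrite addr0; exact: nuQ.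
have sumE i : \sum_y [ffun y => nu y + (y == x)%:R] y * a y i =
    \sum_y nu y * a y i + a x i.
  under eq_bigr do rewrite ffunE mulrDl.
  rewrite big_split /=; congr (_ + _).
  by rewrite (bigD1 x) //= eqxx mul1r big1 ?addr0 // => y /negbTE ->; rewrite mul0r.
under eq_bigr do rewrite sumE.
apply: (le_trans (ler_sum _ (fun i _ => sqr_pos_part_add _ _))).
rewrite !big_split /= -mulr_sumr -natr1 mulrDl mul1r.
have : \sum_i a x i ^+ 2 <= \sum_x \sum_i a x i ^+ 2.
  rewrite [leRHS](bigD1 x) //= lerDl sumr_ge0 // => y _.
  by rewrite sumr_ge0 // => i _; rewrite sqr_ge0.
by move: ax nuB; lra.
Qed.

Lemma approachability a Q (eps : R) : 0 < eps ->
  (forall w : I -> R, (forall i, 0 <= w i) ->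
     exists2 x, Q x & \sum_i w i * a x i <= 0) ->
  exists mu : {ffun X -> R},
    [/\ is_distribution mu, forall x, mu x != 0 -> Q x &
        forall i, \sum_x mu x * a x i <= eps].
Proof.
move=> eps0 /approachability_rounds rounds.
set B := \sum_x \sum_i a x i ^+ 2 in rounds.
have B0 : 0 <= B.
  by rewrite sumr_ge0 // => x _; rewrite sumr_ge0 // => i _; rewrite sqr_ge0.
(* Since [T > B / eps ^+ 2], the bound [T * B] on a squared cumulative payoff is at most
   [(T * eps) ^+ 2]; dividing the payoff by [T] leaves [eps]. *)
pose T := (Num.truncn (B / eps ^+ 2)).+1.
have [nu [nu0 nuT nuQ nuB]] := rounds T.
have T0 : 0 < T%:R :> R by rewrite ltr0n.
have BT : B <= T%:R * eps ^+ 2.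
  by rewrite -ler_pdivrMr ?exprn_gt0 // ltW // truncnS_gt.
exists [ffun x => nu x / T%:R]; split.
- split=> [x|]; first by rewrite ffunE divr_ge0 // ltW.
  under eq_bigr do rewrite ffunE.
  by rewrite -mulr_suml nuT divff // gt_eqF.
- move=> x; rewrite ffunE mulf_eq0 negb_or => /andP[+ _]; exact: nuQ.
move=> i.
have -> : \sum_x [ffun x => nu x / T%:R] x * a x i =
    (\sum_x nu x * a x i) / T%:R.
  by rewrite mulr_suml; apply: eq_bigr => x _; rewrite ffunE mulrAC.
rewrite ler_pdivrMr //.
set y := (X in X <= _).
have [y0|y0] := leP y 0; first by rewrite (le_trans y0) // mulr_ge0 // ltW.
rewrite -(@ler_pXn2r _ 2) // ?nnegrE ?(ltW y0) ?mulr_ge0 ?(ltW T0) ?(ltW eps0) //.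
apply: (@le_trans _ _ (T%:R * B)).
  apply: le_trans nuB; rewrite (bigD1 i) //= -/y maxEle (ltW y0) lerDl sumr_ge0 //.
  by move=> *; rewrite sqr_ge0.
by rewrite exprMn mulrC [T%:R ^+ 2]expr2 mulrA ler_pM2r // mulrC.
Qed.

End Approachability.

(** * Choosing a point of an interval by averaging *)

Section Averaging.
Context {R : realType} {I : finType}.

(** Length of the intersection of [[a, b]] and [[s, t]]. *)
Definition overlap (a b s t : R) : R :=
  Num.max 0 (Num.min b t - Num.max a s).

Lemma overlap_split (a b s q t : R) : s <= q -> q <= t ->
  overlap a b s q + overlap a b q t = overlap a b s t.
Proof.
move=> sq qt; rewrite /overlap.
by case: (leP b q) => ?; case: (leP b t) => ?; case: (leP a s) => ?;
  case: (leP a q) => ?; repeat (case: leP => ?); lra.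
Qed.

Lemma overlap_full (a b s t : R) : a <= s -> t <= b -> s <= t ->
  overlap a b s t = t - s.
Proof.
move=> sa tb st; rewrite /overlap.
by case: (leP b t) => ?; case: (leP a s) => ?; case: leP => ?; lra.
Qed.

Lemma overlap_ge0 (a b s t : R) : 0 <= overlap a b s t.
Proof. by rewrite /overlap le_max lexx. Qed.

Lemma overlap_le (a b s t l : R) : 0 <= l -> b <= a + l ->
  overlap a b s t <= l.
Proof.
move=> l0 bal; rewrite /overlap ge_max l0 /= lerBlDr.
by case: (leP b t) => ?; case: (leP a s) => ?; lra.
Qed.

Lemma overlap_eq0 (a b s t : R) : t <= a -> overlap a b s t = 0.
Proof.
move=> ta; rewrite /overlap.
by case: (leP b t) => ?; case: (leP a s) => ?; case: leP => ?; lra.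
Qed.

(* The integral over [s, t] of the weight of the intervals [a i, b i[ covering a
   point is the sum of the overlaps; [l] lists the points where it jumps. *)
Lemma covering_weight_average (P : pred I) (c a b : I -> R) (l : seq R) :
  (forall i, P i -> 0 <= c i) ->
  forall s t, s < t ->
  (forall i, P i -> (s < b i < t -> b i \in l)) ->
  (forall i, P i -> (s < a i < t -> a i \in l)) ->
  exists r, s <= r < t /\
    (t - s) * (\sum_(i | P i && (a i <= r < b i)) c i)
      <= \sum_(i | P i) c i * overlap (a i) (b i) s t.
Proof.
move=> c0; elim: l => [|q l IH] s t st hb ha.
  (* No endpoint lies strictly between [s] and [t], so an interval that covers [s] covers all of
     [[s, t[]. *)
  exists s; split; first by rewrite lexx.
  rewrite mulr_sumr big_mkcondr; apply: ler_sum => i Pi /=.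
  case: ifP => [/andP[ais sbi]|_]; last by rewrite mulr_ge0 ?overlap_ge0 ?c0.
  rewrite overlap_full ?(ltW st) 1?mulrC // leNgt; apply/negP => bit.
  by have := hb i Pi; rewrite sbi bit => /(_ isT).
have [/andP[sq qt]|nq] := boolP (s < q < t); last first.
  apply: IH => // i Pi h.
  - have := hb _ Pi h; rewrite inE => /orP[/eqP bq|//].
    by rewrite -bq h in nq.
  - have := ha _ Pi h; rewrite inE => /orP[/eqP bq|//].
    by rewrite -bq h in nq.
have [||r1 [/andP[sr1 r1q] h1]] := IH s q sq.
- move=> i Pi /andP[h1 h2]; have := hb i Pi.
  by rewrite h1 (lt_trans h2 qt) inE (lt_eqF h2) => /(_ isT).
- move=> i Pi /andP[h1 h2]; have := ha i Pi.
  by rewrite h1 (lt_trans h2 qt) inE (lt_eqF h2) => /(_ isT).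
have [||r2 [/andP[qr2 r2t] h2]] := IH q t qt.
- move=> i Pi /andP[h3 h2]; have := hb i Pi.
  by rewrite h2 (lt_trans sq h3) inE (gt_eqF h3) => /(_ isT).
- move=> i Pi /andP[h3 h2]; have := ha i Pi.
  by rewrite h2 (lt_trans sq h3) inE (gt_eqF h3) => /(_ isT).
have -> : \sum_(i | P i) c i * overlap (a i) (b i) s t =
    \sum_(i | P i) c i * overlap (a i) (b i) s q +
    \sum_(i | P i) c i * overlap (a i) (b i) q t.
  rewrite -big_split /=; apply: eq_bigr => i _.
  by rewrite -mulrDr overlap_split // ltW.
set C1 := \sum_(i | _) c i in h1; set C2 := \sum_(i | _) c i in h2.
(* The smaller of the two covering weights is at most their average weighted by the lengths of the
   two parts. *)
have [C12|C21] := leP C1 C2.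
- exists r1; split; first by rewrite sr1 (lt_trans r1q qt).
  by rewrite -/C1; nra.
- exists r2; split; first by rewrite (le_trans (ltW sq) qr2).
  by rewrite -/C2; nra.
Qed.

End Averaging.

(** * Volumes and region growing *)

Section RegionGrowing.
Context {R : realType} {V : finType}.
Implicit Types (F S : {set V * V}) (U B : {set V}) (e : V * V) (f : V -> R).

Definition induced_edges F U : {set V * V} :=
  [set e in F | (e.1 \in U) && (e.2 \in U)]%SET.

Definition sublevel U f (r : R) : {set V} := [set x in U | f x <= r]%SET.

(* The orientation [b = false] reverses all edges, so that in-balls are
   out-balls. *)
Definition etail (b : bool) e : V := if b then e.1 else e.2.
Definition ehead (b : bool) e : V := if b then e.2 else e.1.

Definition out_cut F U B (b : bool) : {set V * V} :=
  [set e in induced_edges F U | (etail b e \in B) && (ehead b e \notin B)]%SET.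

(* Each edge gives half of its weight to each endpoint, which makes the volume
   an additive function of [B]; [beta] is the seed weight of a vertex. *)
Definition vol F (w : V * V -> R) (beta : R) U B : R :=
  beta * #|B|%:R +
  \sum_(e in induced_edges F U) w e * ((e.1 \in B)%:R + (e.2 \in B)%:R) / 2.

(** The harmonic number minus its first term: growing ends at scale 1, where no further step is paid
    for. *)
Definition harm (j : nat) : R := \sum_(2 <= i < j.+1) i%:R^-1.

Lemma harmSS j : harm j.+2 = harm j.+1 + j.+2%:R^-1.
Proof. by rewrite /harm big_nat_recr. Qed.

Lemma harm_ge0 j : 0 <= harm j.
Proof. by rewrite /harm sumr_ge0. Qed.

Lemma harm_gt0 j : (1 < j)%N -> 0 < harm j.
Proof.
by case: j => [|[|j]] // _; rewrite harmSS ltr_wpDl ?harm_ge0 // invr_gt0 ltr0n.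
Qed.

Lemma subset_induced F U : induced_edges F U \subset F.
Proof. by apply/fintype.subsetP => e; rewrite inE => /andP[]. Qed.

Section Volume.
Variables (F : {set V * V}) (w l : V * V -> R) (beta : R).
Hypothesis w_ge0 : {in F, forall e, 0 <= w e}.
Hypothesis l_gt0 : {in F, forall e, 0 < l e}.
Hypothesis beta_gt0 : 0 < beta.
Local Notation vol := (vol F w beta).
Local Notation induced_edges := (induced_edges F).

Lemma w_ind_ge0 U e : e \in induced_edges U -> 0 <= w e.
Proof. by move=> /(fintype.subsetP (subset_induced F U)) /w_ge0. Qed.

Lemma l_ind_gt0 U e : e \in induced_edges U -> 0 < l e.
Proof. by move=> /(fintype.subsetP (subset_induced F U)) /l_gt0. Qed.

Lemma vol_mono U B B' : B \subset B' -> vol U B <= vol U B'.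
Proof.
move=> sBB; apply: lerD.
  by rewrite ler_pM2l // ler_nat subset_leq_card.
apply: ler_sum => e eU; rewrite -!mulrA ler_wpM2l ?(w_ind_ge0 eU) //.
rewrite ler_pM2r ?invr_gt0 // lerD // ler_nat.
  by case: (boolP (e.1 \in B)) => // /(fintype.subsetP sBB) ->.
by case: (boolP (e.2 \in B)) => // /(fintype.subsetP sBB) ->.
Qed.

Lemma vol_ge_seed U B : (0 < #|B|)%N -> beta <= vol U B.
Proof.
move=> B0; rewrite -[leLHS]addr0; apply: lerD.
  by rewrite -[leLHS]mulr1 ler_pM2l // ler1n.
by rewrite sumr_ge0 // => e eU; rewrite divr_ge0 // mulr_ge0 ?(w_ind_ge0 eU) ?addr_ge0.
Qed.

Lemma vol_disjoint U B B' : B :&: B' = finset.set0 -> B \subset U -> B' \subset U ->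
  vol U B + vol U B' <= vol U U.
Proof.
move=> dis sBU sB'U.
have dj x : (x \in B)%:R + (x \in B')%:R = (x \in B :|: B')%:R :> R.
  have := finset.in_set0 x; rewrite -dis !inE.
  by case: (x \in B); case: (x \in B') => //= _; rewrite ?addr0 ?add0r.
rewrite (_ : vol U B + vol U B' = vol U (B :|: B')).
  by apply: vol_mono; rewrite finset.subUset sBU.
rewrite /vol addrACA -mulrDr -natrD -cardsUI dis cards0 addn0; congr (_ + _).
rewrite -big_split /=; apply: eq_bigr => e _.
by rewrite -!dj; ring.
Qed.

Lemma vol_setD U B : B \subset U -> vol U B + vol U (U :\: B) = vol U U.
Proof.
move=> sBU.
have dj x : (x \in B)%:R + (x \in U :\: B)%:R = (x \in U)%:R :> R.
  rewrite inE; case: (boolP (x \in B)) => [/(fintype.subsetP sBU) ->|_] /=.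
    by rewrite addr0.
  by rewrite add0r.
rewrite /vol addrACA -mulrDr -natrD -{1}(finset.setIidPr sBU) cardsID; congr (_ + _).
rewrite -big_split /=; apply: eq_bigr => e _.
by rewrite -!dj; ring.
Qed.

(** Passing to the subgraph induced by [B] only loses the half weights of edges between [B] and the
    rest of [U]. This lets the recursion restart on [B]. *)
Lemma vol_restrict U B : B \subset U -> vol B B <= vol U B.
Proof.
move=> sBU; rewrite /vol lerD2l.
rewrite [leLHS]big_mkcond [leRHS]big_mkcond /=.
apply: ler_sum => e _; case: ifP => [eB|_].
  have -> // : e \in induced_edges U.
  move: eB; rewrite !inE => /and3P[-> e1 e2].
  by rewrite !(fintype.subsetP sBU).
by case: ifP => // eU; rewrite divr_ge0 // mulr_ge0 ?(w_ind_ge0 eU) ?addr_ge0.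
Qed.

(** The factor 2 undoes the halving of weights in [vol]. *)
Lemma tail_weight_le_vol U B b :
  \sum_(e in induced_edges U) w e * (etail b e \in B)%:R <= 2 * vol U B.
Proof.
rewrite /vol mulrDr mulr_sumr -[leLHS]add0r; apply: lerD.
  by rewrite mulr_ge0 // mulr_ge0 // ltW.
apply: ler_sum => e eU.
have -> : 2 * (w e * ((e.1 \in B)%:R + (e.2 \in B)%:R) / 2) =
    w e * ((e.1 \in B)%:R + (e.2 \in B)%:R) by field.
rewrite ler_wpM2l ?(w_ind_ge0 eU) //.
by rewrite /etail; case: b; rewrite ?lerDl ?lerDr.
Qed.

Lemma sublevel_sub U f r : sublevel U f r \subset U.
Proof. by apply/fintype.subsetP => x; rewrite inE => /andP[]. Qed.

Lemma sublevel_mono U f r r' : r <= r' -> sublevel U f r \subset sublevel U f r'.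
Proof.
move=> rr'; apply/fintype.subsetP => x; rewrite !inE => /andP[-> /le_trans]; exact.
Qed.

(** An edge is cut exactly at the radii in [[f tail, f head[], an interval of length at most [l e].
    Integrating [w e / l e] over the radii thus charges at most [w e] to each edge whose tail is in
    the larger ball. *)
Lemma ball_cut_average U f b (r r' : R) : r < r' ->
  {in induced_edges U, forall e, f (ehead b e) <= f (etail b e) + l e} ->
  exists rho, r <= rho < r' /\
    (r' - r) * (\sum_(e in out_cut F U (sublevel U f rho) b) w e / l e)
      <= 2 * vol U (sublevel U f r').
Proof.
move=> rr' lip.
have c0 e : e \in induced_edges U -> 0 <= w e / l e.
  by move=> eU; rewrite divr_ge0 ?(w_ind_ge0 eU) // ltW // (l_ind_gt0 eU).
have inl x : f x \in [seq f y | y <- enum V] by rewrite map_f // mem_enum.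
have [rho [rhoI le]] := @covering_weight_average R (V * V)%type
  (fun e => e \in induced_edges U) _ (f \o etail b) (f \o ehead b) _ c0 r r' rr'
  (fun e _ _ => inl (ehead b e)) (fun e _ _ => inl (etail b e)).
exists rho; split => //.
rewrite (eq_bigl (fun e => (e \in induced_edges U) &&
    ((f \o etail b) e <= rho < (f \o ehead b) e))); last first.
  move=> e; rewrite !inE /=; apply: andb_id2l => /and3P[_ e1 e2].
  have [-> ->] : etail b e \in U /\ ehead b e \in U by rewrite /etail /ehead; case: (b).
  by rewrite -ltNge.
apply: (le_trans le); apply: le_trans (tail_weight_le_vol U _ b).
apply: ler_sum => e eU /=.
rewrite -mulrA ler_wpM2l ?(w_ind_ge0 eU) // inE.
have -> : etail b e \in U by move: eU; rewrite inE /etail => /and3P[]; case: (b).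
have le0 := l_ind_gt0 eU.
case: (leP (f (etail b e)) r') => [_|h] /=.
  by rewrite ler_pdivrMl // mulr1 overlap_le ?(ltW le0) // lip.
by rewrite overlap_eq0 ?mulr0 // ltW.
Qed.

(* At scale [j] the ball has volume about [vol U U / 2 ^ j] and the radius grows
   by [delta / j]; either the volume doubles and [j] drops by one, or averaging
   over the step yields a cheap cut. The total radius is a harmonic sum. *)
Lemma ball_growing_scale U f b (delta rmax : R) : 0 < delta ->
  {in induced_edges U, forall e, f (ehead b e) <= f (etail b e) + l e} ->
  vol U (sublevel U f rmax) <= vol U U / 2 ->
  forall (j : nat) (r : R), r + delta * harm j <= rmax ->
  vol U U < 2 ^+ j * vol U (sublevel U f r) ->
  exists rho, r <= rho <= rmax /\
    \sum_(e in out_cut F U (sublevel U f rho) b) w e / l e <=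
    8 / (delta * ln 2) * (vol U (sublevel U f rho) *
      ln (vol U U / vol U (sublevel U f rho))).
Proof.
move=> delta0 lip small; elim=> [|j IH] r hr hv.
  by move: hv; rewrite expr0 mul1r ltNge vol_mono // sublevel_sub.
have volrmax : r <= rmax.
  by apply: le_trans hr; rewrite lerDl mulr_ge0 ?harm_ge0 // ltW.
case: j => [|j] in IH hr hv *.
  (* At scale 1 the ball already holds more than half of the volume, against [small]. *)
  have := vol_mono U (sublevel_mono U f volrmax); rewrite expr1 in hv; lra.
have j0 : 0 < j.+2%:R :> R by rewrite ltr0n.
set r' := r + delta / j.+2%:R.
have rr' : r < r' by rewrite ltrDl divr_gt0.
have hr' : r' + delta * harm j.+1 <= rmax.
  by apply: le_trans hr; rewrite harmSS mulrDr /r' -addrA [X in r + X]addrC lexx.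
(* Either the enlarged ball qualifies for scale [j.+1], or its volume is less than twice that of the
   ball of radius [r]. *)
have [big|small'] := ltP (vol U U) (2 ^+ j.+1 * vol U (sublevel U f r')).
  have [rho [/andP[h1 h2] h3]] := IH _ hr' big.
  by exists rho; split=> //; rewrite h2 (le_trans (ltW rr')).
have [rho [/andP[h1 h2] h3]] := ball_cut_average rr' lip.
have r'max : r' <= rmax.
  by apply: le_trans hr'; rewrite lerDl mulr_ge0 ?harm_ge0 // ltW.
exists rho; split; first by rewrite h1 (le_trans (ltW h2)).
set C := \sum_(e in _) _ in h3 *.
set m := vol U U in hv small' small *; set v := vol U (sublevel U f rho).
have vr : vol U (sublevel U f r) <= v by apply/vol_mono/sublevel_mono.
have vr' : v <= vol U (sublevel U f r') by apply/vol_mono/sublevel_mono/ltW.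
set a := vol U (sublevel U f r) in hv vr; set a' := vol U (sublevel U f r') in h3 small' vr'.
have p0 : 0 < (2 : R) ^+ j.+1 by rewrite exprn_gt0.
have m0 : 0 <= m.
  by rewrite addr_ge0 ?mulr_ge0 ?(ltW beta_gt0) // sumr_ge0 // => e eU;
     rewrite divr_ge0 // mulr_ge0 ?(w_ind_ge0 eU) ?addr_ge0.
have a_gt0 : 0 < a.
  by have := le_lt_trans m0 hv; rewrite pmulr_rgt0 // exprn_gt0.
have v0 : 0 < v := lt_le_trans a_gt0 vr.
have a'v : a' <= 2 * v.
  have hv' : m < 2 * 2 ^+ j.+1 * v.
    by apply: (lt_le_trans hv); rewrite exprS -!mulrA !ler_pM2l.
  by rewrite -(ler_pM2l p0); move: small' hv'; lra.
(* The ball holds at most a fraction [1 / 2 ^+ j.+1] of the volume, so its logarithm pays for the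
   factor [j.+2] due to the step length [delta / j.+2]. *)
have lnm : j.+1%:R * ln 2 <= ln (m / v).
  rewrite mulr_natl -lnXn // ler_ln ?posrE //.
    by rewrite ler_pdivlMr // (le_trans _ small') // ler_pM2l.
  by rewrite divr_gt0 // (lt_le_trans v0) // /v /m vol_mono // sublevel_sub.
have ln2 : 0 < ln 2 :> R by rewrite ln_gt0 // ltr1n.
have jj : j.+2%:R <= 2 * j.+1%:R :> R.
  by rewrite -natrM ler_nat mul2n doubleS !ltnS -addnn leq_addl.
have C_le : C <= j.+2%:R * (4 * v) / delta.
  rewrite ler_pdivlMr //.
  have := h3; rewrite /r' addrAC subrr add0r => h4.
  have : delta * C <= j.+2%:R * (2 * a').
    by rewrite -ler_pdivrMl // mulrA [_^-1 * delta]mulrC.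
  rewrite [C * _]mulrC => /le_trans; apply.
  by rewrite ler_pM2l //; lra.
apply: (le_trans C_le).
rewrite ler_pdivrMr //.
have -> : 8 / (delta * ln 2) * (v * ln (m / v)) * delta =
    8 * v * (ln (m / v) / ln 2).
  by field; rewrite !gt_eqF.
have h5 : j.+1%:R <= ln (m / v) / ln 2 by rewrite ler_pdivlMr.
have v8 : 0 < 8 * v by rewrite mulr_gt0.
apply: (@le_trans _ _ (8 * v * j.+1%:R)); last by rewrite ler_pM2l.
have : 4 * v * j.+2%:R <= 4 * v * (2 * j.+1%:R) by rewrite ler_pM2l // mulr_gt0.
by lra.
Qed.

(** With [delta = D / (2 * harm J)], growing from radius 0 uses a total radius of exactly [D / 2].
    The initial ball contains [u], so its volume is at least [beta], which places it at scale
    [J]. *)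
Lemma ball_growing U f b u (D : R) (J : nat) : 0 < D -> (1 < J)%N ->
  {in induced_edges U, forall e, f (ehead b e) <= f (etail b e) + l e} ->
  u \in U -> f u <= 0 ->
  vol U (sublevel U f (D / 2)) <= vol U U / 2 ->
  vol U U < 2 ^+ J * beta ->
  exists rho, 0 <= rho <= D / 2 /\
    \sum_(e in out_cut F U (sublevel U f rho) b) w e / l e <=
    16 * harm J / (D * ln 2) * (vol U (sublevel U f rho) *
      ln (vol U U / vol U (sublevel U f rho))).
Proof.
move=> D0 J1 lip uU fu small volJ.
have H0 := harm_gt0 J1.
have delta0 : 0 < D / (2 * harm J) by rewrite divr_gt0 // mulr_gt0.
have [||rho [h1 h2]] := ball_growing_scale delta0 lip small (j := J) (r := 0).
- by rewrite add0r le_eqVlt; apply/orP/or_introl/eqP; field; rewrite gt_eqF.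
- apply: (lt_le_trans volJ); rewrite ler_pM2l ?exprn_gt0 //.
  by apply: vol_ge_seed; apply/card_gt0P; exists u; rewrite inE uU.
exists rho; split => //; apply: (le_trans h2); rewrite le_eqVlt; apply/orP; left.
apply/eqP; congr (_ * _); field.
by rewrite !gt_eqF // ln_gt0 // ltr1n.
Qed.

(** Here [a], [b] are the volumes of the two sides within [U], and [a'], [b'] their volumes after
    restriction. The logarithm splits as [ln ((a + b) / a) + ln (a / beta)] on the side [a], which
    pays for the cut; the rest is monotonicity of [x * ln (x / beta)] above [beta]. *)
Lemma potential_split (a b a' b' : R) : beta <= a' -> beta <= b' ->
  a' <= a -> b' <= b ->
  a * ln ((a + b) / a) + a' * ln (a' / beta) + b' * ln (b' / beta)
    <= (a + b) * ln ((a + b) / beta).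
Proof.
move=> ba bb aa b'b.
have a'0 : 0 < a' := lt_le_trans beta_gt0 ba.
have b'0 : 0 < b' := lt_le_trans beta_gt0 bb.
have a0 : 0 < a := lt_le_trans a'0 aa.
have b0 : 0 < b := lt_le_trans b'0 b'b.
have ab0 : 0 < a + b by rewrite addr_gt0.
have xln x y : beta <= x -> x <= y -> x * ln (x / beta) <= x * ln (y / beta).
  move=> bx xy; have x0 := lt_le_trans beta_gt0 bx.
  have y0 := lt_le_trans x0 xy.
  by rewrite ler_pM2l // ler_ln ?posrE ?divr_gt0 // ler_pM2r ?invr_gt0.
have lnb y : beta <= y -> 0 <= ln (y / beta).
  by move=> bx; rewrite ln_ge0 // ler_pdivlMr // mul1r.
have h1 : a' * ln (a' / beta) <= a * ln (a / beta).
  apply: le_trans (xln _ _ ba aa) _.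
  by rewrite ler_wpM2r // lnb // (le_trans ba).
have h2 : b' * ln (b' / beta) <= b * ln ((a + b) / beta).
  apply: le_trans (xln _ (a + b) bb _) _; first lra.
  by rewrite ler_wpM2r // lnb //; lra.
have h3 : ln ((a + b) / beta) = ln ((a + b) / a) + ln (a / beta).
  by rewrite -lnM ?posrE ?divr_gt0 // mulrA divfK // gt_eqF.
have : a * ln ((a + b) / beta) = a * ln ((a + b) / a) + a * ln (a / beta).
  by rewrite h3 mulrDr.
by rewrite [leRHS]mulrDl; lra.
Qed.

End Volume.
End RegionGrowing.

(** * Shortest-path distance and its truncation *)

Section Distance.
Context {R : realType} {V : finType}.
Variable G : wdigraph R V.
Hypothesis len_gt0 : {in edges G, forall e, 0 < len G e}.
Implicit Types (u v x y : V) (p q : seq V) (D r : R).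

Lemma walk_length_cat u p q :
  walk_length G u (p ++ q) = walk_length G u p + walk_length G (last u p) q.
Proof. by rewrite /walk_length pairmap_cat big_cat. Qed.

Lemma walk_length_ge0 u p : path (adj (edges G)) u p -> 0 <= walk_length G u p.
Proof.
elim: p u => [|x p IH] u; first by rewrite /walk_length big_nil.
rewrite /= => /andP[ux px]; rewrite /walk_length /= big_cons addr_ge0 //.
  exact/ltW/len_gt0.
exact: IH.
Qed.

Lemma dist_ge0 u v : (0 <= dist G u v)%E.
Proof.
apply: le_ereal_inf_tmp => _ [p [pp _] <-]; rewrite lee_fin; exact: walk_length_ge0.
Qed.

Lemma dist_le_walk u p : path (adj (edges G)) u p ->
  (dist G u (last u p) <= (walk_length G u p)%:E)%E.
Proof. by move=> pp; apply: ereal_inf_lbound; exists p. Qed.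

Lemma dist_refl u : (dist G u u <= 0)%E.
Proof.
by have := @dist_le_walk u [::] isT; rewrite /walk_length /= big_nil.
Qed.

Lemma dist_edge u v : (u, v) \in edges G -> (dist G u v <= (len G (u, v))%:E)%E.
Proof.
move=> uv; have := @dist_le_walk u [:: v].
by rewrite /walk_length /= big_seq1 andbT; apply.
Qed.

Lemma dist_triangle u v x : (dist G u v <= dist G u x + dist G x v)%E.
Proof.
have ux0 := dist_ge0 u x; have xv0 := dist_ge0 x v.
have [uxfin|] := boolP (dist G u x \is a fin_num); last first.
  rewrite ge0_fin_numE // -leNgt leye_eq => /eqP ->.
  by rewrite addye ?leey // gt_eqF // (lt_le_trans _ xv0) // ltNye.
have [xvfin|] := boolP (dist G x v \is a fin_num); last first.
  rewrite ge0_fin_numE // -leNgt leye_eq => /eqP ->.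
  by rewrite addey ?leey // gt_eqF // (lt_le_trans _ ux0) // ltNye.
apply/lee_addgt0Pr => eps eps0.
have eps2 : 0 < eps / 2 by rewrite divr_gt0.
have [_ [p [pp lp] <-] hp] := lb_ereal_inf_adherent eps2 uxfin.
have [_ [q [pq lq] <-] hq] := lb_ereal_inf_adherent eps2 xvfin.
have := @dist_le_walk u (p ++ q).
rewrite cat_path pp lp pq last_cat lp lq walk_length_cat lp => /(_ isT) h.
apply: (le_trans h); rewrite EFinD.
have -> : eps%:E = ((eps / 2)%:E + (eps / 2)%:E)%E.
  by rewrite -EFinD; congr (_%:E); lra.
by rewrite addeACA; apply: leeD; apply: ltW.
Qed.

(** Region growing needs a real-valued radius function, while [dist] may be infinite. Truncation at
    [D] keeps all balls of radius below [D]. *)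
Definition trunc_dist D u v : R := fine (mine (dist G u v) D%:E).

Lemma trunc_distE D u v : 0 <= D ->
  (trunc_dist D u v)%:E = mine (dist G u v) D%:E.
Proof.
move=> D0; rewrite fineK // ge0_fin_numE.
  by rewrite gt_min ltry orbT.
by rewrite le_min dist_ge0 lee_fin.
Qed.

Lemma trunc_dist_refl D u : 0 <= D -> trunc_dist D u u <= 0.
Proof. by move=> D0; rewrite -lee_fin trunc_distE // ge_min dist_refl. Qed.

Lemma trunc_dist_ler D u v r : 0 <= D -> r < D -> trunc_dist D u v <= r ->
  (dist G u v <= r%:E)%E.
Proof.
move=> D0 rD; rewrite -lee_fin trunc_distE // ge_min => /orP[//|].
by rewrite lee_fin leNgt rD.
Qed.

Lemma trunc_dist_lip D u v x y r : 0 <= D -> 0 <= r ->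
  (dist G u v <= dist G x y + r%:E)%E ->
  trunc_dist D u v <= trunc_dist D x y + r.
Proof.
move=> D0 r0 h; rewrite -lee_fin EFinD !trunc_distE //.
have [h1|h1] := leP (dist G x y) D%:E; first by rewrite ge_min h.
by rewrite ge_min -EFinD !lee_fin lerDl r0 orbT.
Qed.

End Distance.

(** * Strong components and one-way cuts *)

Section Components.
Context {V : finType}.
Implicit Types (F : {set V * V}) (A : {set V}).

Lemma same_scc_sub F F' u v : F \subset F' -> same_scc F u v -> same_scc F' u v.
Proof.
move=> sF /andP[uv vu].
have mono : subrel (connect (adj F)) (connect (adj F')).
  by apply: connect_sub => x y xy; apply/connect1/(fintype.subsetP sF).
by rewrite /same_scc !mono.
Qed.

(** A walk cannot leave [A]. Walks starting in [A] therefore stay there, and walks ending outside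
    [A] never visit it, so the walks joining [u] and [v] both ways remain on one side. *)
Lemma same_scc_side F A u v :
  {in F, forall e, e.1 \in A -> e.2 \in A} -> same_scc F u v ->
  exists2 X, X = A \/ X = finset.setC A &
    [/\ u \in X, v \in X & same_scc (induced_edges F X) u v].
Proof.
move=> clA /andP[uv vu].
have up x p : path (adj F) x p -> x \in A ->
    path (adj (induced_edges F A)) x p /\ last x p \in A.
  elim: p x => //= y p IH x /andP[xy yp] xA.
  have xyF : (x, y) \in F := xy; have yA : y \in A := clA _ xy xA.
  by have [-> ->] := IH y yp yA; rewrite andbT /adj /= inE xA yA xyF.
have down x p : path (adj F) x p -> last x p \notin A ->
    path (adj (induced_edges F (finset.setC A))) x p /\ x \notin A.
  elim: p x => //= y p IH x /andP[xy yp] lA.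
  have [-> yA] := IH y yp lA; rewrite andbT.
  have xA : x \notin A by apply: contra yA => /(clA _ xy).
  have xyF : (x, y) \in F := xy.
  by rewrite /adj /= !inE xA yA xyF.
have [p pp lp] := connectP uv; have [q pq lq] := connectP vu.
have [uA|uA] := boolP (u \in A).
- have [h1 h2] := up _ _ pp uA; rewrite -lp in h2.
  have [h3 _] := up _ _ pq h2.
  exists A; first by left.
  by split=> //; apply/andP; split; apply/connectP; [exists p|exists q].
- have [h1 h2] := down _ _ pq (eq_ind _ (fun z => z \notin A) uA _ lq).
  have [h3 _] := down _ _ pp (eq_ind _ (fun z => z \notin A) h2 _ lp).
  exists (finset.setC A); first by right.
  rewrite !inE; split=> //.
  by apply/andP; split; apply/connectP; [exists p|exists q].
Qed.

End Components.

(** * Recursive separation at low cost *)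

Section Decomposition.
Context {R : realType} {V : finType}.
Variables (G : wdigraph R V) (w : V * V -> R) (beta D : R) (J : nat).
Hypothesis len_gt0 : {in edges G, forall e, 0 < len G e}.
Hypothesis w_ge0 : {in edges G, forall e, 0 <= w e}.
Hypothesis beta_gt0 : 0 < beta.
Hypothesis D_gt0 : 0 < D.
Hypothesis J_gt1 : (1 < J)%N.
Implicit Types (U B : {set V}) (S : {set V * V}).
Local Notation vol := (vol (edges G) w beta).
Local Notation induced_edges := (induced_edges (edges G)).
Local Notation out_cut := (out_cut (edges G)).
Local Notation K := (16 * harm J / (D * ln 2)).

Let cost S : R := \sum_(e in S) w e / len G e.

(** Distances are taken in the whole of [G], not in the subgraph induced by [U]. One direction
    suffices, since [same_scc] is symmetric. *)
Definition separating U S :=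
  {in U &, forall u v, same_scc (induced_edges U :\: S) u v -> (dist G u v <= D%:E)%E}.

Lemma cheap_separation U u v : u \in U -> v \in U -> (D%:E < dist G u v)%E ->
  vol U U < 2 ^+ J * beta ->
  exists b B, [/\ B \subset U, (0 < #|B|)%N, (0 < #|U :\: B|)%N &
    cost (out_cut U B b) <= K * (vol U B * ln (vol U U / vol U B))].
Proof.
move=> uU vU uv volJ.
have D0 := ltW D_gt0.
(* Radius [D / 2] lies below the truncation level, so truncated balls are true balls. *)
have D2 : D / 2 < D by move: D_gt0; lra.
(* A set with at most half of the volume is not all of [U], whose volume is positive thanks to the
   seeds. *)
have half_lt B : B \subset U -> vol U B <= vol U U / 2 -> (0 < #|U :\: B|)%N.
  move=> sBU hB; rewrite lt0n; apply/negP; rewrite cards_eq0 => /eqP UB0.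
  have := vol_setD (edges G) w beta sBU; rewrite UB0.
  have -> : vol U finset.set0 = 0.
    rewrite /vol cards0 mulr0 add0r big1 // => e _.
    by rewrite !finset.in_set0 addr0 mulr0 mul0r.
  have := @vol_ge_seed _ _ (edges G) w beta w_ge0 beta_gt0 U U.
  by move=> /(_ (ltac:(by apply/card_gt0P; exists u))); move: beta_gt0 hB; lra.
pose fo x := trunc_dist G D u x; pose fi x := trunc_dist G D x v.
have dis : sublevel U fo (D / 2) :&: sublevel U fi (D / 2) = finset.set0.
  apply/finset.setP => x; rewrite !inE; apply/negP.
  move=> /andP[/andP[_ h1] /andP[_ h2]].
  have := dist_triangle len_gt0 u v x; rewrite leNgt => /negP; apply.
  apply: le_lt_trans uv.
  have -> : D%:E = ((D / 2)%:E + (D / 2)%:E)%E.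
    by rewrite -EFinD; congr (_%:E); lra.
  by apply: leeD; exact: (trunc_dist_ler len_gt0 D0 D2).
have sum := vol_disjoint (w := w) w_ge0 beta_gt0 dis (sublevel_sub _ _ _) (sublevel_sub _ _ _).
have lipo : {in induced_edges U, forall e, fo (ehead true e) <= fo (etail true e) + len G e}.
  move=> [x y] /(fintype.subsetP (subset_induced _ _)) xy.
  apply: trunc_dist_lip => //; first exact/ltW/len_gt0.
  apply: le_trans (dist_triangle len_gt0 _ _ x) _.
  by rewrite leeD2l // dist_edge.
have lipi : {in induced_edges U, forall e, fi (ehead false e) <= fi (etail false e) + len G e}.
  move=> [x y] /(fintype.subsetP (subset_induced _ _)) xy.
  apply: trunc_dist_lip => //; first exact/ltW/len_gt0.
  apply: le_trans (dist_triangle len_gt0 _ _ y) _.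
  by rewrite addeC leeD2l // dist_edge.
have finish b f c : c \in U -> f c <= 0 ->
    {in induced_edges U, forall e, f (ehead b e) <= f (etail b e) + len G e} ->
    vol U (sublevel U f (D / 2)) <= vol U U / 2 ->
    exists b B, [/\ B \subset U, (0 < #|B|)%N, (0 < #|U :\: B|)%N &
      cost (out_cut U B b) <= K * (vol U B * ln (vol U U / vol U B))].
  move=> cU fc lip small.
  have [rho [/andP[r0 rD] le]] :=
    ball_growing w_ge0 len_gt0 beta_gt0 D_gt0 J_gt1 lip cU fc small volJ.
  exists b, (sublevel U f rho); split=> //.
  - exact: sublevel_sub.
  - by apply/card_gt0P; exists c; rewrite inE cU (le_trans fc).
  - apply: half_lt; first exact: sublevel_sub.
    by apply: le_trans small; apply: vol_mono => //; apply: sublevel_mono.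
have [h|h] := leP (vol U (sublevel U fo (D / 2))) (vol U U / 2).
- by apply: (finish true fo u) => //; apply: trunc_dist_refl.
- apply: (finish false fi v) => //; last by lra.
  exact: trunc_dist_refl.
Qed.

(** Once the cut is removed, no edge leaves [B] when [b] is true, and none enters it when [b] is
    false. [same_scc_side] then confines each component to [B] or to its complement. *)
Lemma separating_split U B b S1 S2 : B \subset U ->
  separating B S1 -> separating (U :\: B) S2 ->
  separating U (out_cut U B b :|: S1 :|: S2).
Proof.
move=> sBU sep1 sep2 u v uU vU scc.
set F := induced_edges U :\: _ in scc.
pose A := if b then B else finset.setC B.
have clA : {in F, forall e, e.1 \in A -> e.2 \in A}.
  move=> e; rewrite finset.in_setD !finset.in_setU !negb_or => /andP[/andP[/andP[eC _] _] eU].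
  move: eC; rewrite finset.in_set eU /= negb_and negbK /A /etail /ehead.
  case: (b); rewrite ?finset.in_setC.
    by case/orP=> [/negbTE ->|->].
  by case/orP=> [-> //|->].
have [X XA [uX vX sccX]] := same_scc_side clA scc.
have [XB|XB] : X = B \/ X = finset.setC B.
- by move: XA; rewrite /A; case: (b) => -[] ->; rewrite ?finset.setCK; [left|right|right|left].
- rewrite XB in uX vX sccX; apply: sep1 => //; apply: same_scc_sub sccX.
  apply/fintype.subsetP => e; rewrite !finset.in_set !negb_or.
  by move=> /andP[/andP[/andP[/andP[_ ->] _] /andP[-> _]] ->].
- rewrite XB !finset.in_setC in uX vX sccX.
  apply: sep2; rewrite ?finset.in_setD ?uX ?vX //; apply: same_scc_sub sccX.
  apply/fintype.subsetP => e; rewrite !finset.in_set !negb_or.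
  by move=> /andP[/andP[/andP[_ ->] /and3P[-> -> ->]] /andP[-> ->]].
Qed.

Lemma low_cost_separation U : (0 < #|U|)%N -> vol U U < 2 ^+ J * beta ->
  exists S, [/\ S \subset induced_edges U, separating U S &
    cost S <= K * (vol U U * ln (vol U U / beta))].
Proof.
have [n] := ubnP #|U|; elim: n U => // n IH U; rewrite ltnS => Un U0 volJ.
have ln2 : 0 < ln 2 :> R by rewrite ln_gt0 // ltr1n.
have K0 : 0 <= K by rewrite divr_ge0 ?mulr_ge0 ?harm_ge0 // ltW.
have [/existsP[u /existsP[v /and3P[uU vU uv]]]|far] :=
    boolP [exists u, exists v, [&& u \in U, v \in U & (D%:E < dist G u v)%E]].
  have [b [B [sBU B0 UB0 cB]]] := cheap_separation uU vU uv volJ.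
  have cardU : (#|B| + #|U :\: B| = #|U|)%N.
    by rewrite -{1}(finset.setIidPr sBU) cardsID.
  have sUBU : U :\: B \subset U by apply: subsetDl.
  have vB : vol B B <= vol U B by exact: vol_restrict.
  have vUB : vol (U :\: B) (U :\: B) <= vol U (U :\: B) by exact: vol_restrict.
  have volU := vol_setD (edges G) w beta sBU.
  have vB0 : beta <= vol B B by exact: vol_ge_seed.
  have vUB0 : beta <= vol (U :\: B) (U :\: B) by exact: vol_ge_seed.
  have [|||S1 [sub1 sep1 c1]] := IH B => //.
  - by apply: leq_trans Un; rewrite -cardU -addn1 leq_add2l.
  - by move: vUB0 vUB vB volU volJ beta_gt0; lra.
  have [|||S2 [sub2 sep2 c2]] := IH (U :\: B) => //.
  - by apply: leq_trans Un; rewrite -cardU -add1n leq_add2r.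
  - by move: vB0 vB vUB volU volJ beta_gt0; lra.
  exists (out_cut U B b :|: S1 :|: S2); split.
  - rewrite !finset.subUset; apply/andP; split; first (apply/andP; split).
    + by apply/fintype.subsetP => e; rewrite inE => /andP[].
    + apply: fintype.subset_trans sub1 _; apply/fintype.subsetP => e.
      by rewrite !finset.in_set => /and3P[-> /(fintype.subsetP sBU) -> /(fintype.subsetP sBU) ->].
    + apply: fintype.subset_trans sub2 _; apply/fintype.subsetP => e.
      by rewrite !finset.in_set => /and3P[-> /andP[_ ->] /andP[_ ->]].
  - exact: separating_split.
  have cost_ge0 e : e \in edges G -> 0 <= w e / len G e.
    by move=> eG; rewrite divr_ge0 ?w_ge0 // ltW // len_gt0.
  have costU S S' : S \subset edges G -> S' \subset edges G ->
      cost (S :|: S') <= cost S + cost S'.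
    move=> sS sS'; rewrite /cost big_mkcond [X in X + _]big_mkcond.
    rewrite [X in _ + X]big_mkcond -big_split; apply: ler_sum => e _ /=.
    rewrite finset.in_setU; case: (boolP (e \in S)) => [eS|_] /=; last by rewrite add0r.
    rewrite lerDl; case: ifP => // eS'.
    exact/cost_ge0/(fintype.subsetP sS').
  have sub1' := fintype.subset_trans sub1 (subset_induced _ _).
  have sub2' := fintype.subset_trans sub2 (subset_induced _ _).
  have cutG : out_cut U B b \subset edges G.
    by apply/fintype.subsetP => e; rewrite !finset.in_set => /andP[/andP[]].
  have h1 := costU _ _ cutG sub1'.
  have h2 : cost (out_cut U B b :|: S1 :|: S2) <= cost (out_cut U B b :|: S1) + cost S2.
    by apply: costU; rewrite // finset.subUset cutG.
  (* The cut and the two recursive costs add up to at most [K] times the potential of [U]. *)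
  have := potential_split beta_gt0 vB0 vUB0 vB vUB; rewrite volU.
  by move=> /(ler_wpM2l K0); rewrite !mulrDr; lra.
(* No two vertices of [U] are far apart in [G], so nothing has to be removed. *)
exists finset.set0; split; first exact: finset.sub0set.
- move=> u v uU vU _; rewrite leNgt; apply: contra far => uv.
  by apply/existsP; exists u; apply/existsP; exists v; rewrite uU vU uv.
- rewrite /cost big_set0 mulr_ge0 // mulr_ge0 //.
    by rewrite (le_trans (ltW beta_gt0)) // vol_ge_seed.
  by rewrite ln_ge0 // ler_pdivlMr // mul1r vol_ge_seed.
Qed.

End Decomposition.

(** * Asymptotics of the loss *)

Section Loss.
Context {R : realType}.

(* With [J = scale n] the seed weight [W / n] is more than a fraction [1 / 2 ^ J]
   of the initial volume [2 * W]. *)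
Definition scale (n : nat) : nat := (trunc_log 2 n).+2.

(** This is [D * K] times the initial potential [2 * W * ln (2 * W / beta)], divided by [W], for
    [beta = W / n]. *)
Definition loss (n : nat) : R := 32 * harm (scale n) / ln 2 * ln (2 * n%:R).

(** Each term [1 / j] is at most [- ln (1 - 1 / j) = ln j - ln (j - 1)], and these telescope. *)
Lemma harm_le_ln j : (0 < j)%N -> harm j <= ln j%:R :> R.
Proof.
case: j => // j _; elim: j => [|j IH]; first by rewrite /harm big_geq // ln1.
rewrite harmSS (le_trans (lerD IH (lexx _))) // -lerBrDl -[leLHS]opprK lerNl opprB.
have j1 : 0 < j.+1%:R :> R by rewrite ltr0n.
have j2 : 0 < j.+2%:R :> R by rewrite ltr0n.
have j1E : j.+1%:R = j.+2%:R - 1 :> R by rewrite -[j.+2%:R]natr1 addrK.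
rewrite -ln_div ?posrE //.
have -> : j.+1%:R / j.+2%:R = 1 + - j.+2%:R^-1 :> R.
  by rewrite j1E mulrBl divff ?gt_eqF // mul1r.
apply: le_ln1Dx; rewrite ltrN2 invf_lt1 // ltr1n //.
Qed.

Lemma ln2_ge_half : 2^-1 <= ln 2 :> R.
Proof.
rewrite -[leRHS]opprK -lnV ?posrE // lerNr.
have -> : 2^-1 = 1 + - 2^-1 :> R by lra.
by apply: le_trans (le_ln1Dx _) _; lra.
Qed.

Lemma loss_eqO :
  (fun n => loss n + 1) =O_\oo (fun n : nat => ln (n%:R : R) * ln (ln (n%:R : R))).
Proof.
(* The loss contributes 256, and the added 1 is at most [x * ln x], where [x = ln n]. The threshold
   on [n] ensures [x >= 3] and [ln x >= 1]. *)
apply/eqOP; exists 257; split; first exact: num_real.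
move=> k k257; exists (Num.truncn (expR (3 + expR 1) : R)).+1 => // n /= hn.
have n3 : expR (3 + expR 1) <= n%:R :> R.
  by apply/ltW/(lt_le_trans (truncnS_gt _)); rewrite ler_nat.
have n0 : 0 < n%:R :> R := lt_le_trans (expR_gt0 _) n3.
set x := ln n%:R.
have e0 : 0 < expR 1 :> R := expR_gt0 1.
have xe : 3 + expR 1 <= x by rewrite -[leLHS]expRK ler_ln ?posrE ?expR_gt0.
have x3 : 3 <= x by lra.
have n_gt0 : (0 < n)%N by rewrite -(ltr_nat R).
have h2 := ln2_ge_half.
have lnx : 1 <= ln x.
  by rewrite -[leLHS](expRK 1) ler_ln ?posrE //; lra.
have lnn : ln (2 * n%:R) <= 2 * x :> R.
  rewrite lnM ?posrE // -/x; have := ln_sublinear (ltr0Sn R 1).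
  by move: x3; lra.
have lnn0 : 0 <= ln (2 * n%:R) :> R.
  by rewrite ln_ge0 // -natrM ler1n muln_gt0.
(* The crude square is harmless: only the logarithm of [scale n] matters. *)
have sx : (scale n)%:R <= x ^+ 2 :> R.
  have : (trunc_log 2 n)%:R * ln 2 <= x.
    rewrite mulr_natl -lnXn // ler_ln ?posrE ?exprn_gt0 //.
    by rewrite -natrX ler_nat trunc_logP.
  rewrite /scale -(addn2 (trunc_log 2 n)) natrD => h.
  have := ler_wpM2l (ler0n R (trunc_log 2 n)) h2.
  have : 3 * x <= x ^+ 2 by rewrite expr2 ler_pM2r //; lra.
  by lra.
have hx : harm (scale n) <= 2 * ln x.
  apply: le_trans (harm_le_ln _) _ => //.
  rewrite mulr_natl -lnXn; last lra.
  by rewrite ler_ln ?posrE ?ltr0n // exprn_gt0; lra.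
have h0 := @harm_ge0 R (scale n).
have : loss n <= 256 * (x * ln x).
  rewrite /loss.
  have i2 : (ln 2)^-1 <= 2 :> R by rewrite invf_ple ?posrE //; lra.
  have i0 : 0 <= (ln 2)^-1 :> R by rewrite invr_ge0; lra.
  apply: (@le_trans _ _ (32 * (2 * ln x) * 2 * (2 * x))); last by lra.
  by rewrite !ler_pM ?mulr_ge0 ?ler_wpM2l.
have l0 : 0 <= loss n.
  by rewrite /loss mulr_ge0 // divr_ge0 ?mulr_ge0 //; lra.
have xl : 1 <= x * ln x by nra.
rewrite !ger0_norm; [|by lra|by lra].
by move=> h; nra.
Qed.

End Loss.

(** * From weighted separations to a distribution *)

Section Main.
Context {R : realType} {V : finType}.
Variables (G : wdigraph R V) (D : R).
Hypothesis len_gt0 : {in edges G, forall e, 0 < len G e}.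
Hypothesis D_gt0 : 0 < D.

Definition low_diameter (S : {set V * V}) : Prop :=
  S \subset edges G /\
  forall u v, same_scc (edges G :\: S) u v -> (dist G u v <= D%:E)%E.

Lemma low_diameter_all : low_diameter (edges G).
Proof.
split=> // u v; rewrite finset.setDv => /andP[/connectP[[|x p] /= + ->] _].
  by rewrite (le_trans (dist_refl _ _)) // lee_fin ltW.
by rewrite /adj /= finset.in_set0.
Qed.

Lemma weighted_low_diameter (w : V * V -> R) : (forall e, 0 <= w e) ->
  exists2 S, low_diameter S &
    D * \sum_(e in S) w e / len G e <= loss #|V| * \sum_(e in edges G) w e.
Proof.
move=> w0; set W := \sum_(e in edges G) w e.
(* With zero total weight there is no positive seed, but removing every edge costs nothing. *)
have [W0|] := eqVneq W 0.
  exists (edges G); first exact: low_diameter_all.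
  rewrite W0 mulr0 big1 ?mulr0 // => e eG.
  have := W0; move/eqP; rewrite psumr_eq0 // => /allP /(_ e).
  by rewrite mem_index_enum eG => /(_ isT) /= /eqP ->; rewrite mul0r.
move=> Wn0; have W0 : 0 < W by rewrite lt_def Wn0 sumr_ge0.
have V0 : (0 < #|V|)%N.
  rewrite lt0n; apply: contraNneq Wn0 => V0; rewrite /W big1 // => -[x y] _.
  by have := card0_eq V0 x; rewrite inE.
have n0 : 0 < #|V|%:R :> R by rewrite ltr0n.
(* The seeds add up to [W], so the initial volume is [2 * W], that is [2 * n] seeds. *)
pose beta := W / #|V|%:R.
have beta0 : 0 < beta by rewrite divr_gt0.
have indT : induced_edges (edges G) [set: V]%SET = edges G.
  by apply/finset.setP => e; rewrite finset.in_set !finset.in_setT !andbT.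
have volT : vol (edges G) w beta [set: V]%SET [set: V]%SET = 2 * W.
  rewrite /vol indT cardsT /beta divfK ?gt_eqF //.
  rewrite (eq_bigr w) => [|e _]; first by rewrite -/W; lra.
  by rewrite !finset.in_setT /= -mulrA divff ?mulr1 ?pnatr_eq0.
have volb : 2 * W / beta = 2 * #|V|%:R.
  by rewrite /beta; field; rewrite !gt_eqF.
have [||S [sub sep cost]] := @low_cost_separation R V G w beta D (scale #|V|)
    len_gt0 (fun e _ => w0 e) beta0 D_gt0 isT [set: V]%SET.
- by rewrite cardsT.
- rewrite volT -ltr_pdivrMr // volb -natrM -natrX ltr_nat /scale expnS.
  by rewrite ltn_pmul2l // trunc_log_ltn.
rewrite /separating indT in sep; rewrite indT in sub; rewrite volT volb in cost.
exists S; first by split=> // u v; apply: sep (finset.in_setT u) (finset.in_setT v).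
have := cost; rewrite -(ler_pM2l D_gt0) => /le_trans; apply.
rewrite /loss le_eqVlt; apply/orP; left; apply/eqP; field.
by rewrite !gt_eqF // ln_gt0 // ltr1n.
Qed.

(** The payoff of an edge is the excess of [D / len G e], counted if the edge is removed, over the
    loss. Approachability with error 1 bounds its expectation by 1, whence [loss + 1]. *)
Lemma directed_ldd_exists :
  exists mu : {ffun {set V * V} -> R}, is_directed_ldd G D (loss #|V| + 1) mu.
Proof.
pose a (S : {set V * V}) e :=
  if e \in edges G then (e \in S)%:R * (D / len G e) - loss #|V| else 0.
have [|mu [mud muQ mua]] := @approachability R _ _ a low_diameter 1 ltr01.
  move=> w w0; have [S Sld cost] := weighted_low_diameter w0.
  exists S => //.
  have -> : \sum_e w e * a S e =
      D * (\sum_(e in S) w e / len G e) - loss #|V| * \sum_(e in edges G) w e.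
    rewrite !mulr_sumr [X in _ = X - _]big_mkcond [X in _ = _ - X]big_mkcond.
    rewrite -sumrB; apply: eq_bigr => e _ /=; rewrite /a.
    have [eG|eG] := boolP (e \in edges G).
      by case: (e \in S); rewrite /= ?mul1r ?mul0r; ring.
    rewrite ifF; first by rewrite mulr0 subrr.
    by apply: contraNF eG => /(fintype.subsetP Sld.1).
  by rewrite subr_le0.
exists mu; split=> //.
- by move=> S /muQ[].
- move=> S /muQ[_ ld] u v uv; split; apply: ld => //.
  by rewrite /same_scc andbC.
move=> e eG; have l0 := len_gt0 eG.
have := mua e; rewrite /a eG.
under eq_bigr do rewrite mulrBr [mu _ * (_ * _)]mulrA.
rewrite sumrB -!mulr_suml mud.2 mul1r lerBlDr.
have -> : \sum_S mu S * (e \in S)%:R = Prob mu (fun S => e \in S).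
  rewrite /Prob [RHS]big_mkcond; apply: eq_bigr => S _.
  by case: ifP => _; rewrite ?mulr1 ?mulr0.
rewrite addrC -ler_pdivlMr ?divr_gt0 // => h; apply: (le_trans h).
by rewrite invf_div mulrC.
Qed.

End Main.

Theorem theorem2p1 (R : realType) (p : {poly R}) :
  exists L : nat -> R,
    L =O_\oo (fun n : nat => ln (n%:R : R) * ln (ln (n%:R : R))) /\
    forall (V : finType) (G : wdigraph R V),
      (forall e, e \in edges G -> 0 < len G e <= p.[#|V|%:R]) ->
      forall D : R, 1 <= D ->
      exists mu : {ffun {set V * V} -> R},
        is_directed_ldd G D (L #|V|) mu.
Proof.
exists (fun n => loss n + 1); split; first exact: loss_eqO.
move=> V G hG D D1; apply: directed_ldd_exists; last exact: lt_le_trans D1.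
by move=> e /hG /andP[].
Qed.
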